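(* Let $p$ be a prime and let $(A,+,\cdot)$ be a pre-Lie algebra over $\mathbb{F}_p$ with $(A,+)\cong C_p^5$, generated by three elements $x,y,z$ (and by no fewer elements) as a pre-Lie algebra. Suppose $A^{[2]}\neq 0$ and $A^{[3]}=0$. Then the following hold. (1) There exist $u,v\in A^{[2]}$ such that $\{x,y,z,u,v\}$ is a basis of the $\mathbb{F}_p$-vector space $A$. (2) $A^{[2]}=\mathbb{F}_pu+\mathbb{F}_pv$. (3) For $i,j\in\{x,y,z\}$ one has $i\cdot j=\alpha_{ij}u+\beta_{ij}v$ with $\alpha_{ij},\beta_{ij}\in\mathbb{F}_p$, where at least two of the tuples $(\alpha_{ij},\beta_{ij})$ are different from $(0,0)$ and are not scalar multiples of each other.
   Context: A pre-Lie algebra over $\mathbb{F}_p$ is an $\mathbb{F}_p$-vector space $A$ with a bilinear product $\cdot$ satisfying $(a\cdot b)\cdot c-a\cdot(b\cdot c)=(b\cdot a)\cdot c-b\cdot(a\cdot c)$ for all $a,b,c\in A$. For subspaces $B,C\subseteq A$, $B\cdot C$ denotes the subspace spanned by all $b\cdot c$ with $b\in B$, $c\in C$. Define $A^{[1]}=A$ and $A^{[i+1]}=\sum_{j=1}^{i}A^{[j]}\cdot A^{[i+1-j]}$ for $i\ge 1$. *)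

(* Defs.v *)
From HB Require Import structures.
From mathcomp Require Import all_boot all_order all_algebra all_field.

Set Implicit Arguments.
Unset Strict Implicit.
Unset Printing Implicit Defensive.

Import GRing.Theory.

Local Open Scope ring_scope.

Definition left_pre_Lie (R : nzRingType) (A : lmodType R) (mul : A -> A -> A) :=
  forall a b c : A,
    mul (mul a b) c - mul a (mul b c) = mul (mul b a) c - mul b (mul a c).

Section PreLie.
Variables (F : finFieldType) (A : vectType F) (mul : {bilinear A -> A -> A}).

(* finvect_type is A with its finType structure: F and \dim A are finite. *)
Definition vs_enum (B : {vspace A}) : seq A :=
  enum [pred a : finvect_type A | (a : A) \in B].

Lemma mem_vs_enum (B : {vspace A}) (a : A) : (a \in vs_enum B) = (a \in B).
Proof. exact: (mem_enum [pred a : finvect_type A | (a : A) \in B] a). Qed.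

Definition mul_vs (B C : {vspace A}) : {vspace A} :=
  <<[seq mul b c | b <- vs_enum B, c <- vs_enum C]>>%VS.

Lemma mul_vsP (B C W : {vspace A}) :
  reflect (forall b c, b \in B -> c \in C -> mul b c \in W)
          (mul_vs B C <= W)%VS.
Proof.
apply: (iffP span_subvP) => [BCW b c Bb Cc | BCW a /allpairsP[[b c] /= []]].
  by apply/BCW/allpairsP; exists (b, c); rewrite !mem_vs_enum.
by rewrite !mem_vs_enum => Bb Cc ->; apply: BCW.
Qed.

(* [:: A^[1]; ...; A^[n]], so that A^[k.+1] is the item of index k. *)
Fixpoint bracket_powers (n : nat) : seq {vspace A} :=
  if n is m.+1 then
    let s := bracket_powers m in
    rcons s (if m is 0 then fullv
             else (\sum_(k < m) mul_vs (nth 0 s k) (nth 0 s (m - k.+1)))%VS)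
  else [::].

(* Only meaningful for n > 0; bracket_pow 0 is a dummy value. *)
Definition bracket_pow (n : nat) : {vspace A} := nth 0%VS (bracket_powers n) n.-1.

Lemma size_bracket_powers n : size (bracket_powers n) = n.
Proof. by elim: n => //= n IHn; rewrite size_rcons IHn. Qed.

Lemma nth_bracket_powers n k :
  (k < n)%N -> nth 0%VS (bracket_powers n) k = bracket_pow k.+1.
Proof.
elim: n => // n IHn; rewrite ltnS leq_eqVlt => /predU1P[-> // | lt_kn] /=.
by rewrite nth_rcons size_bracket_powers lt_kn IHn.
Qed.

Lemma bracket_pow1 : bracket_pow 1 = fullv.
Proof. by []. Qed.

Lemma bracket_powS i : (0 < i)%N ->
  bracket_pow i.+1 =
    (\sum_(1 <= j < i.+1) mul_vs (bracket_pow j) (bracket_pow (i.+1 - j)))%VS.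
Proof.
case: i => // i _; rewrite big_add1 big_mkord.
rewrite {1}/bracket_pow [bracket_powers _]/= -/(bracket_powers i.+1).
rewrite nth_rcons size_rcons size_bracket_powers ltnn eqxx.
apply: eq_bigr => k _; rewrite -/(bracket_powers i.+1).
rewrite !(@nth_bracket_powers i.+1) ?ltn_ord ?ltn_subrL //.
by rewrite -subSn.
Qed.

Definition pre_Lie_subalgebra (W : {vspace A}) :=
  forall a b, a \in W -> b \in W -> mul a b \in W.

Definition generates (s : seq A) :=
  forall W : {vspace A}, {subset s <= W} -> pre_Lie_subalgebra W -> W = fullv.

End PreLie.

Definition scalar_multiple (R : nzRingType) (s t : R * R) :=
  exists c : R, s = (c * t.1, c * t.2).

(* Main.v *)
Require Import Defs.
From HB Require Import structures.
From mathcomp Require Import all_boot all_order all_algebra all_field.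

Set Implicit Arguments.
Unset Strict Implicit.
Unset Printing Implicit Defensive.

Import GRing.Theory.

Local Open Scope ring_scope.

(** Write A2 for A^[2]. Since A^[3] = 0, every product with a factor in A2
    vanishes, so a product a . b depends only on the classes of a and b modulo
    A2. Hence a family s generates A exactly when its span together with A2 is
    all of A ([generatesP]): as in the Burnside basis theorem, A2 consists of
    non-generators. Lifting a basis of A / A2 gives a generating family, so the
    minimality of three generators gives 3 + dim A2 <= dim A = 5
    ([bracket2_codim_ge]); conversely x, y, z span A modulo A2, so that
    dim A2 = 2 and x, y, z are independent modulo A2.

    The same vanishing shows that A2 is spanned by the products of two elements
    of {x, y, z} alone ([bracket2_span]). As A2 is a plane, two of these
    products are linearly independent; taking them for u and v makes their
    coordinate pairs (1, 0) and (0, 1), which are not multiples of each other. *)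

Section LinearAlgebra.
Variables (K : fieldType) (V : vectType K).

Lemma span_has_free_pair (s : seq V) :
  (1 < \dim <<s>>)%N -> exists u v, [/\ u \in s, v \in s & free [:: u; v]].
Proof.
move=> dim_s.
(* A family whose span lies in a line cannot span a plane. *)
have notin_line w : exists2 v, v \in s & v \notin <[w]>%VS.
  apply/hasP/negPn/negP => /hasPn s_line.
  have /dimvS : (<<s>> <= <[w]>)%VS.
    by apply/span_subvP => v /s_line; rewrite negbK.
  by rewrite dim_vline leqNgt (leq_trans _ dim_s) // ltnS leq_b1.
have [v sv v_neq0] := notin_line 0.
have [u su uv] := notin_line v.
exists u, v; split=> //.
rewrite free_cons span_seq1 uv seq1_free.
by apply: contraNneq v_neq0 => ->; rewrite mem0v.
Qed.

End LinearAlgebra.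

Section TripleProductsVanish.
Variables (F : finFieldType) (A : vectType F) (mul : {bilinear A -> A -> A}).

Local Notation A2 := (bracket_pow mul 2).

Lemma bracket_pow2E : A2 = mul_vs mul fullv fullv.
Proof. by rewrite bracket_powS // big_nat1 bracket_pow1. Qed.

Lemma mul_in_bracket2 a b : mul a b \in A2.
Proof.
rewrite bracket_pow2E.
by move/mul_vsP: (subvv (mul_vs mul fullv fullv)); apply; rewrite memvf.
Qed.

Lemma mul_span_sub (s : seq A) (W : {vspace A}) :
  (forall i j, i \in s -> j \in s -> mul i j \in W) ->
  forall a b, a \in <<s>>%VS -> b \in <<s>>%VS -> mul a b \in W.
Proof.
move=> sW a b sa sb.
rewrite (coord_span (X := in_tuple s) sa) (coord_span (X := in_tuple s) sb).
rewrite linear_sumlz; apply: memv_suml => i _.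
rewrite linear_sumr; apply: memv_suml => j _.
by rewrite linearZl_LR linearZr_LR !memvZ // sW // mem_nth.
Qed.

Hypothesis A3_eq0 : bracket_pow mul 3 = 0%VS.

Lemma mul_bracket2_eq0 a b : a \in A2 -> mul a b = 0 /\ mul b a = 0.
Proof.
move=> A2a; move/eqP: A3_eq0; rewrite -subv0 bracket_powS //.
rewrite big_nat_recr //= big_nat1 bracket_pow1 subv_add => /andP[].
move=> /mul_vsP mulA_A2 /mul_vsP mulA2_A.
by split; apply/eqP; rewrite -memv0; [apply: mulA2_A | apply: mulA_A2];
  rewrite ?memvf.
Qed.

Lemma mul_mod_bracket2 a b c d :
  c \in A2 -> d \in A2 -> mul (a + c) (b + d) = mul a b.
Proof.
move=> A2c A2d; rewrite linearDr /= !linearDl.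
have [-> _] := mul_bracket2_eq0 b A2c; have [-> _] := mul_bracket2_eq0 d A2c.
by have [_ ->] := mul_bracket2_eq0 a A2d; rewrite !addr0.
Qed.

(** Products only depend on their factors modulo A2, so representatives modulo
    A2 already produce all of A2. *)
Lemma bracket2_sub (U W : {vspace A}) :
  (U + A2)%VS = fullv ->
  (forall a b, a \in U -> b \in U -> mul a b \in W) -> (A2 <= W)%VS.
Proof.
move=> U_A2 UW; rewrite [A2 in (A2 <= _)%VS]bracket_pow2E.
apply/mul_vsP=> a b _ _.
have [/memv_addP[a0 Ua [a1 A2a ->]] /memv_addP[b0 Ub [b1 A2b ->]]] :
  a \in (U + A2)%VS /\ b \in (U + A2)%VS by rewrite U_A2 !memvf.
by rewrite mul_mod_bracket2 ?UW.
Qed.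

Lemma bracket2_span (s : seq A) :
  (<<s>> + A2)%VS = fullv -> A2 = <<[seq mul i j | i <- s, j <- s]>>%VS.
Proof.
move=> s_A2; apply/eqP; rewrite eqEsubv; apply/andP; split.
  apply: (bracket2_sub s_A2); apply: mul_span_sub => i j si sj.
  by apply/memv_span/allpairs_f.
by apply/span_subvP => _ /allpairsP[[i j] /= [_ _ ->]]; apply: mul_in_bracket2.
Qed.

(** The span plus A2 is a subalgebra because it contains all products. In the
    other direction, a subalgebra which is full modulo A2 contains A2, since it
    contains the products of its own representatives modulo A2. *)
Lemma generatesP (s : seq A) :
  generates mul s <-> (<<s>> + A2)%VS = fullv.
Proof.
split=> [s_gen | s_A2 W sW W_alg].
  apply: s_gen => [a sa | a b _ _].
    by apply: (subvP (addvSl _ _)); apply: memv_span.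
  by apply: (subvP (addvSr _ _)); apply: mul_in_bracket2.
have sWv : (<<s>> <= W)%VS by apply/span_subvP.
apply/eqP; rewrite eqEsubv subvf -s_A2 subv_add sWv /=.
apply: (bracket2_sub s_A2) => a b sa sb.
by apply: W_alg; apply: (subvP sWv).
Qed.

(** A basis of a complement of A2 is a generating family. *)
Lemma bracket2_codim_ge (n : nat) :
  (forall s : seq A, generates mul s -> (n <= size s)%N) ->
  (n + \dim A2 <= \dim {: A})%N.
Proof.
move=> n_min.
have := n_min (vbasis A2^C); rewrite size_tuple => le_n.
rewrite -(subnK (dimvS (subvf A2))) leq_add2r -dimv_compl le_n //.
by apply/generatesP; rewrite (span_basis (vbasisP _)) addvC addv_complf.
Qed.

End TripleProductsVanish.

(** The dimension is read off from the cardinal p ^ dim A. *)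
Lemma dim_of_bij_rV (p n : nat) (p_prime : prime p) (A : vectType 'F_p)
    (f : A -> 'rV['F_p]_n) : bijective f -> \dim {: A} = n.
Proof.
move=> f_bij.
have := bij_eq_card (f_bij : @bijective _ (finvect_type A) f).
rewrite card_mx mul1n card_Fp //.
rewrite -(card_vspacef (Vector.on (finvect_type A))) card_vspace card_Fp //.
by move/eqP; rewrite eqn_exp2l ?prime_gt1 // => /eqP.
Qed.

Theorem theorem6p1p1 (p : nat) (p_prime : prime p)
    (A : vectType 'F_p) (mul : {bilinear A -> A -> A})
    (mul_pre_Lie : left_pre_Lie mul)
    (A_isog : exists f : {additive A -> 'rV['F_p]_5}, bijective f)
    (x y z : A)
    (xyz_gen : generates mul [:: x; y; z])
    (gen_min : forall s : seq A, generates mul s -> (3 <= size s)%N)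
    (A2_neq0 : bracket_pow mul 2 <> 0%VS)
    (A3_eq0 : bracket_pow mul 3 = 0%VS) :
  exists u v : A,
    [/\ [/\ u \in bracket_pow mul 2, v \in bracket_pow mul 2
          & basis_of fullv [:: x; y; z; u; v]],
        bracket_pow mul 2 = (<[u]> + <[v]>)%VS
      & exists alpha beta : A -> A -> 'F_p,
          (forall i j, i \in [:: x; y; z] -> j \in [:: x; y; z] ->
             mul i j = alpha i j *: u + beta i j *: v) /\
          (exists i j k l : A,
             [/\ [/\ i \in [:: x; y; z], j \in [:: x; y; z],
                     k \in [:: x; y; z] & l \in [:: x; y; z]],
                 (i, j) <> (k, l),
                 (alpha i j, beta i j) <> (0, 0),
                 (alpha k l, beta k l) <> (0, 0)
               & ~ scalar_multiple (alpha i j, beta i j) (alpha k l, beta k l) /\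
                 ~ scalar_multiple (alpha k l, beta k l) (alpha i j, beta i j)])].
Proof.
have [f /(dim_of_bij_rV p_prime) dimA] := A_isog.
have xyz_A2 := (generatesP A3_eq0 _).1 xyz_gen.
have dim_A2_le : (\dim (bracket_pow mul 2) <= 2)%N.
  by have := bracket2_codim_ge A3_eq0 gen_min; rewrite dimA (leq_add2l 3 _ 2).
have dim_A2 : \dim (bracket_pow mul 2) = 2.
  apply/eqP; rewrite eqn_leq dim_A2_le -(leq_add2l 3) -[(3 + 2)%N]dimA -xyz_A2.
  rewrite (leq_trans (dimv_add_leqif _ _)) // leq_add2r.
  exact: (dim_span [:: x; y; z]).
have A2_span := bracket2_span A3_eq0 xyz_A2.
have [u [v [prod_u prod_v uv_free]]] :
    exists u v, [/\ u \in [seq mul i j | i <- [:: x; y; z], j <- [:: x; y; z]],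
                    v \in [seq mul i j | i <- [:: x; y; z], j <- [:: x; y; z]]
                  & free [:: u; v]].
  by apply: span_has_free_pair; rewrite -A2_span dim_A2.
have [[i j] /= [xyz_i xyz_j u_ij]] := allpairsP prod_u.
have [[k l] /= [xyz_k xyz_l v_kl]] := allpairsP prod_v.
have uv_span : <<[:: u; v]>>%VS = bracket_pow mul 2.
  apply/eqP; rewrite eqEdim dim_A2 (eqP uv_free) leqnn andbT.
  by apply/span_subvP => w; rewrite !inE => /orP[] /eqP->;
    rewrite ?u_ij ?v_kl; apply: mul_in_bracket2.
exists u, v; split.
- split; [by rewrite u_ij mul_in_bracket2 | by rewrite v_kl mul_in_bracket2 |].
  rewrite basisEdim dimA leqnn andbT.
  by rewrite (span_cat [:: x; y; z] [:: u; v]) uv_span xyz_A2 subvv.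
- by rewrite -uv_span span_cons span_seq1.
(* Coordinates in the basis u, v of A2: u and v, being products themselves,
   get the pairs (1, 0) and (0, 1). *)
pose c n i j := coord [tuple u; v] n (mul i j).
have coord_u n : c n i j = (0 == n)%:R.
  by rewrite /c -u_ij; apply: (coord_free (X := [tuple u; v]) 0 n).
have coord_v n : c n k l = (1 == n)%:R.
  by rewrite /c -v_kl; apply: (coord_free (X := [tuple u; v]) 1 n).
exists (c 0), (c 1); split=> [a b _ _ |].
  have := mul_in_bracket2 mul a b; rewrite -uv_span.
  move=> /(coord_span (X := [tuple u; v])) {1}->.
  rewrite !big_ord_recl big_ord0 addr0.
  by congr (_ + coord _ _ _ *: _); apply: val_inj.
exists i, j, k, l; rewrite !coord_u !coord_v /=.
split=> //.
- move=> [eq_ik eq_jl]; move: uv_free; rewrite u_ij v_kl eq_ik eq_jl.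
  by rewrite free_cons span_seq1 memv_line.
by split; case=> t /eqP; rewrite xpair_eqE /= mulr0 oner_eq0 ?andbF.
Qed.
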